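(* Let $A\in\mathcal{S}$ be arbitrary. Then for every integer $d\geqslant 2$, $$ s_d(x;A) \succ s_{d-1}(x;A), \quad\text{i.e.}\quad \lim_{x\to+\infty}\frac{s_{d-1}(x;A)}{s_d(x;A)}=0. $$
   Context: $\mathcal{S}$ denotes the set of infinite subsets of $\mathbb{Z}_{\geqslant 0}$ (strictly increasing sequences of nonnegative integers). For $A\in\mathcal{S}$, $r(n;A)=r_1(n;A)$ is $1$ if $n\in A$ and $0$ otherwise; for $d\geqslant 2$, $r_d(n;A)=\sum_{k_1+\dots+k_d=n} r(k_1;A)\cdots r(k_d;A)$ (the number of ordered $d$-tuples of elements of $A$ summing to $n$). For real $x\geqslant 0$, $s(x;A)=s_1(x;A)=|A\cap[0,x]|$ and $s_d(x;A)=\sum_{0\leqslant n\leqslant x} r_d(n;A)$. Notation $f\succ g$ means $g=o(f)$ as $x\to+\infty$. *)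

(* Defs.v *)
From mathcomp Require Import all_boot all_order all_algebra.
From mathcomp Require Import all_classical all_reals all_analysis.

Set Implicit Arguments.
Unset Strict Implicit.
Unset Printing Implicit Defensive.

Import Order.TTheory GRing.Theory Num.Theory.
Import numFieldNormedType.Exports.

Local Open Scope classical_set_scope.
Local Open Scope ring_scope.

Definition r (A : set nat) (n : nat) : nat := (n \in A).

(* Each [k i] lies in [0, n], which is no restriction for nonnegative integers
   summing to [n]. For [d = 1] this is [r A n], see [rd1]. *)
Definition rd (d : nat) (A : set nat) (n : nat) : nat :=
  (\sum_(k : {ffun 'I_d -> 'I_n.+1} | \sum_(i < d) k i == n)
     \prod_(i < d) r A (k i))%N.

(* [Num.truncn x] is the integer part of [x] for [0 <= x]; the filter makes
   the sum range over exactly the [n] with [0 <= n <= x] for every real [x]. *)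
Definition sd (R : realType) (d : nat) (A : set nat) (x : R) : R :=
  \sum_(0 <= n < (Num.truncn x).+1 | n%:R <= x) (rd d A n)%:R.

Canonical pinfty_filter_on (R : realType) :=
  FilterType (pinfty_nbhs R) _.

(* [f] dominates [g], i.e. [g = o(f)] at [+oo]. *)
Definition dominates (R : realType) (f g : R -> R) : Prop :=
  (g : R -> R^o) =o_ (pinfty_nbhs R) (f : R -> R^o).

Lemma dominatesP (R : realType) (f g : R -> R) :
  dominates f g <->
  forall eps : R, 0 < eps -> \forall x \near +oo, `|g x| <= eps * `|f x|.
Proof. by split=> /eqoP. Qed.

Lemma rd1 (A : set nat) (n : nat) : rd 1 A n = r A n.
Proof.
rewrite /rd (big_pred1 [ffun=> ord_max]) => [|k /=].
  by rewrite big_ord1 ffunE.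
rewrite big_ord1; apply/eqP/eqP => [kn|->]; last by rewrite ffunE.
by apply/ffunP => i; rewrite ffunE (ord1 i); apply/val_inj.
Qed.

Lemma sd1 (R : realType) (A : set nat) (x : R) : 0 <= x ->
  sd 1 A x = #|[set n : 'I_(Num.truncn x).+1 | (n : nat) \in A]%SET|%:R.
Proof.
move=> x0; rewrite /sd big_nat_cond.
rewrite (eq_bigl (fun n => 0 <= n < (Num.truncn x).+1)%N).
  rewrite -big_nat big_mkord -natr_sum; congr (_%:R).
  under eq_bigr do rewrite rd1 /r.
  rewrite -sum1dep_card [RHS]big_mkcond /=.
  by apply: eq_bigr => i _; case: (_ \in A).
move=> n /=; case: (ltnP n) => //= nx.
by rewrite -truncn_ge_nat.
Qed.

(* Main.v *)
Require Import Defs.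
From mathcomp Require Import all_boot all_order all_algebra.
From mathcomp Require Import all_classical all_reals all_analysis.
From mathcomp Require Import zify.

Set Implicit Arguments.
Unset Strict Implicit.
Unset Printing Implicit Defensive.

Import Order.TTheory GRing.Theory Num.Theory.
Import numFieldNormedType.Exports.

Local Open Scope classical_set_scope.
Local Open Scope ring_scope.

(** Write [S d N] for [s_d(N; A)].  A [(d+1)]-tuple summing to [n] is determined
    by its last [d] entries, so [r_(d+1)(n) <= S d n] and hence
    [S (d+1) N <= S (d+1) (N - j) + j * S d N].  On the other hand
    [S (d+2) N >= \sum_(j <= M, j in A) S (d+1) (N - j)] for every fixed [M].
    If [S d = o(S (d+1))], each summand is at least half of [S (d+1) N] for
    large [N], and the number of summands is unbounded in [M] since [A] is
    infinite; therefore [S (d+1) = o(S (d+2))]. The induction starts from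
    [S 0 = 1] and [S 1 N = |A `&` [0, N]|]. *)

(** The coefficient of index [i] in a product involves only coefficients of index at most [i] of the
    factors. *)
Lemma coef_exp_eq (V : nzSemiRingType) (p q : {poly V}) (n d : nat) :
  (forall i, (i <= n)%N -> p`_i = q`_i) ->
  forall i, (i <= n)%N -> (p ^+ d)`_i = (q ^+ d)`_i.
Proof.
move=> pq; elim: d => [//|d IHd] i le_in.
rewrite !exprS !coefM; apply: eq_bigr => j _.
by rewrite pq ?IHd //; have := ltn_ord j; lia.
Qed.

(** The generating series of [A] cut off after degree [N], so that counting tuples becomes taking
    coefficients of powers. *)
Definition genpoly (A : set nat) (N : nat) : {poly nat} :=
  \poly_(i < N.+1) r A i.

Lemma rd_genpoly_diag (d : nat) (A : set nat) (n : nat) :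
  rd d A n = (genpoly A n ^+ d)`_n.
Proof.
rewrite -[d in RHS]card_ord -prodr_const /genpoly.
(* Expanding the product of [d] sums gives one monomial per tuple [f], of degree the sum of its
   entries. *)
rewrite poly_def bigA_distr_bigA /= coef_sum /rd big_mkcond.
apply: eq_bigr => f _.
have -> : \prod_(i in 'I_d) (r A (f i) *: 'X^(f i))
    = (\prod_(i < d) r A (f i))%N *: ('X^(\sum_(i < d) f i)%N : {poly nat}).
  by rewrite scaler_prod -expr_sum.
rewrite coefZ coefXn eq_sym.
by case: eqP => _; rewrite ?mulr1 ?mulr0.
Qed.

Lemma rd_genpoly (d : nat) (A : set nat) (n N : nat) : (n <= N)%N ->
  rd d A n = (genpoly A N ^+ d)`_n.
Proof.
move=> nN; rewrite rd_genpoly_diag; apply: (@coef_exp_eq _ _ _ n) => // i le_in.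
by rewrite !coef_poly !ltnS le_in (leq_trans le_in nN).
Qed.

Lemma rd0 (A : set nat) (n : nat) : rd 0 A n = (n == 0)%N.
Proof. by rewrite rd_genpoly_diag expr0 coef1; case: eqP. Qed.

Lemma rdS (d : nat) (A : set nat) (n : nat) :
  rd d.+1 A n = (\sum_(j < n.+1) r A j * rd d A (n - j))%N.
Proof.
rewrite rd_genpoly_diag exprS coefM; apply: eq_bigr => j _.
by rewrite coef_poly ltn_ord -rd_genpoly // leq_subr.
Qed.

Definition sdn (d : nat) (A : set nat) (N : nat) : nat :=
  (\sum_(n < N.+1) rd d A n)%N.

Lemma sdn0 (A : set nat) (N : nat) : sdn 0 A N = 1%N.
Proof.
rewrite /sdn big_ord_recl rd0 /= big1 ?addn0 // => i _.
by rewrite rd0.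
Qed.

Lemma leq_sdn (d : nat) (A : set nat) : {homo sdn d A : m n / (m <= n)%N}.
Proof.
apply: (@homo_leq _ (sdn d A) leq) => [n|m n p|n]; [exact: leqnn|exact: leq_trans|].
by rewrite [leqRHS]big_ord_recr leq_addr.
Qed.

Lemma rdS_le_sdn (d : nat) (A : set nat) (n : nat) :
  (rd d.+1 A n <= sdn d A n)%N.
Proof.
(* Reversing the index aligns both sums at [n - j]; then [r A j] is at most 1. *)
rewrite rdS /sdn [leqRHS](reindex_inj rev_ord_inj) /=.
apply: leq_sum => j _; rewrite subSS /r.
by case: (_ \in A); rewrite ?mul1n.
Qed.

Lemma sdn_shift (d : nat) (A : set nat) (N j : nat) : (j <= N)%N ->
  (sdn d.+1 A N <= sdn d.+1 A (N - j) + j * sdn d A N)%N.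
Proof.
elim: j => [|j IHj] jN; first by rewrite subn0 leq_addr.
apply: leq_trans (IHj (ltnW jN)) _; rewrite -(subnSK jN) {1}/sdn big_ord_recr /=.
rewrite -/(sdn _ _ _) mulSn addnA leq_add2r leq_add2l.
apply: leq_trans (rdS_le_sdn _ _ _) (leq_sdn _ _ _); lia.
Qed.

(** Sort the tuples by their first entry [j]: the other [d] entries have sum at most [N - j]. *)
Lemma sdnS (d : nat) (A : set nat) (N : nat) :
  sdn d.+1 A N = (\sum_(j < N.+1) r A j * sdn d A (N - j))%N.
Proof.
elim: N => [|N IHN].
  by rewrite /sdn !big_ord1 rdS !big_ord1.
rewrite {1}/sdn big_ord_recr /= -/(sdn _ _ _) IHN rdS.
rewrite [X in (_ + X)%N]big_ord_recr [RHS]big_ord_recr /= !subnn addnA; congr addn; last first.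
  by rewrite /sdn big_ord1.
rewrite -big_split; apply: eq_bigr => j _ /=.
by rewrite -mulnDr (subSn (ltn_ord j : (j <= N)%N)) /sdn [in RHS]big_ord_recr.
Qed.

Lemma sdn_ge (d : nat) (A : set nat) (M N : nat) : (M <= N)%N ->
  (\sum_(j < M.+1) r A j * sdn d A (N - j) <= sdn d.+1 A N)%N.
Proof.
move=> MN; rewrite sdnS.
rewrite -(big_mkord xpredT (fun j => (r A j * sdn d A (N - j))%N)).
rewrite -(big_mkord xpredT (fun j => (r A j * sdn d A (N - j))%N)).
by rewrite [leqRHS](@big_cat_nat _ _ _ M.+1) //= leq_addr.
Qed.

Lemma infinite_set_nat_gt (A : set nat) : infinite_set A ->
  forall N, exists2 n, A n & (N < n)%N.
Proof.
move=> hA N; apply: contrapT => noA; apply: hA.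
apply: (sub_finite_set _ (finite_II N.+1)) => n An /=.
by rewrite ltnS leqNgt; apply/negP => Nn; apply: noA; exists n.
Qed.

Lemma sum_r_unbounded (A : set nat) : infinite_set A ->
  forall K, exists M, (K <= \sum_(j < M.+1) r A j)%N.
Proof.
move=> hA; elim=> [|K [M KM]]; first by exists 0%N.
(* An element of [A] beyond [M] raises the count by one; it exceeds [M], hence is a successor. *)
have [[//|n] An Mn] := infinite_set_nat_gt hA M.
exists n.+1; rewrite big_ord_recr /= {2}/r mem_set // addn1 ltnS.
apply: leq_trans KM _.
rewrite -(big_mkord xpredT (r A)) -(big_mkord xpredT (r A)).
by rewrite [leqRHS](@big_cat_nat _ _ _ M.+1) //= leq_addr.
Qed.

Lemma sdn_dominates (A : set nat) (d : nat) : infinite_set A ->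
  forall K, exists N0, forall N, (N0 <= N)%N -> (K * sdn d A N <= sdn d.+1 A N)%N.
Proof.
move=> hA; elim: d => [|d IHd] K.
  have [M KM] := sum_r_unbounded hA K; exists M => N MN.
  rewrite sdn0 muln1; apply: leq_trans KM _.
  apply: leq_trans (sdn_ge 0 A MN).
  by apply: leq_sum => j _; rewrite sdn0 muln1.
have [M KM] := sum_r_unbounded hA (2 * K).
(* With factor [2 * M], a shift by [j <= M] costs at most half of [sdn d.+1 A N]; the factor [2 * K]
   above makes up for this half. *)
have [N0 HN0] := IHd (2 * M)%N.
exists (maxn M N0) => N; rewrite geq_max => /andP[MN /HN0 half].
rewrite -(@leq_pmul2l 2) //; apply: leq_trans (leq_mul (leqnn 2) (sdn_ge _ _ MN)).
rewrite mulnA; apply: leq_trans (leq_mul KM (leqnn _)) _.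
rewrite big_distrl big_distrr /=; apply: leq_sum => j _.
rewrite mulnCA leq_mul2l; apply/orP; right.
have jM : (j <= M)%N by rewrite -ltnS.
have := sdn_shift d A (leq_trans jM MN).
have := leq_mul jM (leqnn (sdn d A N)); lia.
Qed.

Lemma sd_sdn (R : realType) (d : nat) (A : set nat) (x : R) : 0 <= x ->
  sd d A x = (sdn d A (Num.truncn x))%:R.
Proof.
move=> x0; rewrite /sd /sdn natr_sum -(big_mkord xpredT (fun n => (rd d A n)%:R)).
rewrite [LHS]big_nat_cond [RHS]big_nat_cond; apply: eq_bigl => n /=.
by rewrite andbT; case: (ltnP n) => //= nx; rewrite -truncn_ge_nat.
Qed.

Lemma sd_ge0 (R : realType) (d : nat) (A : set nat) (x : R) : 0 <= sd d A x.
Proof. by apply: sumr_ge0. Qed.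

Lemma sd_le_eps (R : realType) (A : set nat) (d : nat) (eps : R) :
  infinite_set A -> 0 < eps ->
  \forall x \near +oo, sd d A x <= eps * sd d.+1 A x.
Proof.
move=> hA eps0; pose K := (Num.truncn eps^-1).+1.
have [N0 HN0] := sdn_dominates d hA K.
have Keps : eps^-1 <= K%:R by apply/ltW/truncnS_gt.
near=> x.
have x0 : 0 <= x by near: x; apply: nbhs_pinfty_ge; rewrite num_real.
have Nx : (N0 <= Num.truncn x)%N.
  by rewrite truncn_ge_nat //; near: x; apply: nbhs_pinfty_ge; rewrite num_real.
rewrite !sd_sdn // -ler_pdivrMl //.
apply: (@le_trans _ _ (K%:R * (sdn d A (Num.truncn x))%:R)).
  by rewrite ler_wpM2r.
by rewrite -natrM ler_nat HN0.
Unshelve. all: by end_near. Qed.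

Theorem theorem2p5 (R : realType) (A : set nat) (hA : infinite_set A)
    (d : nat) (hd : (2 <= d)%N) :
  dominates (@sd R d A) (@sd R d.-1 A) /\
  sd d.-1 A x / sd d A x @[x --> +oo] --> (0 : R).
Proof.
case: d hd => [//|d] _ /=; split.
  apply/dominatesP => eps eps0.
  apply: filterS (sd_le_eps d hA eps0) => x.
  by rewrite !ger0_norm ?sd_ge0.
apply/cvgr0Pnorm_le => eps eps0.
apply: filterS (sd_le_eps d hA eps0) => x le_eps.
rewrite ger0_norm ?divr_ge0 ?sd_ge0 //.
(* If the denominator vanishes, the quotient is 0 by convention. *)
have [->|s_neq0] := eqVneq (sd d.+1 A x) 0; first by rewrite invr0 mulr0 ltW.
by rewrite ler_pdivrMr // lt_neqAle eq_sym s_neq0 sd_ge0.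
Qed.
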